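(* Let $G=(V,E)$ be a simple graph and let $v\in V$ be a pendant vertex (i.e. $\deg(v)=1$) with $uv\in E$. Then $$\gamma_{\rm st}(G)-1\leq \gamma_{\rm st}(G/v)\leq \gamma_{\rm st}(G)+\deg(u)-1.$$ Furthermore, these bounds are tight: each of the two inequalities holds with equality for some such graph $G$ and pendant vertex $v$.
   Context: For a simple graph $H$, a set $D\subseteq V(H)$ is a strong dominating set of $H$ if for every vertex $x\in V(H)\setminus D$ there is a vertex $y\in D$ with $xy\in E(H)$ and $\deg_H(x)\leq \deg_H(y)$. The strong domination number $\gamma_{\rm st}(H)$ is the minimum cardinality of a strong dominating set of $H$. The contraction of a vertex $v$ in $G$, denoted $G/v$, is the graph obtained from $G$ by deleting $v$ (and its incident edges) and adding edges so that the open neighbourhood $N(v)$ of $v$ induces a clique (for a pendant vertex this is simply $G-v$). $\deg(u)$ is the degree of $u$ in $G$. *)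

(* Defs.v *)
From mathcomp Require Import all_boot.

Set Implicit Arguments.
Unset Strict Implicit.
Unset Printing Implicit Defensive.

Record sgraph := SGraph {
  vertex :> finType;
  adj : rel vertex;
  adj_sym : symmetric adj;
  adj_irrefl : irreflexive adj
}.

Definition nbhd (G : sgraph) (x : G) : {set G} := [set y | adj x y].

Definition deg (G : sgraph) (x : G) : nat := #|nbhd x|.

Definition strong_dominating (G : sgraph) (D : {set G}) : bool :=
  [forall x, (x \notin D) ==> [exists y in D, adj x y && (deg x <= deg y)]].

Lemma strong_dominatingT (G : sgraph) : strong_dominating [set: G].
Proof. by apply/forallP => x; rewrite inE. Qed.

Definition gamma_st (G : sgraph) : nat :=
  #|[arg min_(D < [set: G] | strong_dominating D) #|D|]|.

Lemma gamma_st_le (G : sgraph) (D : {set G}) :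
  strong_dominating D -> gamma_st G <= #|D|.
Proof.
rewrite /gamma_st; case: arg_minnP => [|D0 _ minD0]; last exact: minD0.
exact: strong_dominatingT.
Qed.

Lemma gamma_st_attained (G : sgraph) :
  exists2 D : {set G}, strong_dominating D & #|D| = gamma_st G.
Proof.
rewrite /gamma_st; case: arg_minnP => [|D0 sD0 _]; last by exists D0.
exact: strong_dominatingT.
Qed.

Definition contract_adj (G : sgraph) (v : G) : rel {x : G | x != v} :=
  fun x y => (x != y) &&
    (adj (val x) (val y) || (val x \in nbhd v) && (val y \in nbhd v)).

Lemma contract_adj_sym (G : sgraph) (v : G) : symmetric (contract_adj (v := v)).
Proof. by move=> x y; rewrite /contract_adj eq_sym adj_sym (andbC (val x \in _)). Qed.

Lemma contract_adj_irrefl (G : sgraph) (v : G) :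
  irreflexive (contract_adj (v := v)).
Proof. by move=> x; rewrite /contract_adj eqxx. Qed.

(* The graph G/v on V(G) \ {v}: v is deleted and N(v) is made a clique. *)
Definition contract (G : sgraph) (v : G) : sgraph :=
  SGraph (@contract_adj_sym G v) (@contract_adj_irrefl G v).

(* Main.v *)
Require Import Defs.
From mathcomp Require Import all_boot.

(** Contracting a pendant vertex [v] just deletes it, which lowers the degree of
    its neighbour [u] by one and changes no other degree. Hence adding [u] to a
    strong dominating set of [G/v] gives one of [G]. Conversely, if [D] is
    strong dominating in [G], then so is [D :|: N[u]] minus [v] in [G/v], as the
    vertices outside it are dominated by neither [u] nor [v]; its size is at
    most [#|D| + deg u - 1] because [D] meets [{u, v}]. The lower bound is
    attained by the path on four vertices, the upper bound by a single edge. *)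

Lemma strong_dominatingP (G : sgraph) (D : {set G}) :
  reflect (forall x, x \notin D -> exists y, [/\ y \in D, adj x y & deg x <= deg y])
          (strong_dominating D).
Proof.
apply: (iffP forallP) => [sD x xD | sD x].
  have /implyP/(_ xD)/existsP[y /and3P[yD xy le_xy]] := sD x.
  by exists y.
apply/implyP => /sD[y [yD xy le_xy]].
by apply/existsP; exists y; rewrite yD xy.
Qed.

Lemma gamma_st_gt0 (G : sgraph) (x : G) : 0 < gamma_st G.
Proof.
have [D /strong_dominatingP sD <-] := gamma_st_attained G.
apply/card_gt0P; have [xD | /sD[y [yD _ _]]] := boolP (x \in D); first by exists x.
by exists y.
Qed.

(** The vertex [x] rules out an empty dominating set, and a dominating set with one element would
    consist of a vertex adjacent to all others. *)
Lemma gamma_st_gt1 (G : sgraph) (x : G) :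
  (forall y : G, exists2 z, z != y & ~~ adj z y) -> 1 < gamma_st G.
Proof.
move=> non_univ; have [D /strong_dominatingP sD defD] := gamma_st_attained G.
rewrite ltn_neqAle (gamma_st_gt0 G x) andbT eq_sym -defD.
apply/negP => /cards1P[y Dy]; have [z zy /negP nzy] := non_univ y.
have /sD[t []] : z \notin D by rewrite Dy inE.
by rewrite Dy inE => /eqP->.
Qed.

(** A vertex adjacent to all others has the largest possible degree, so the degree condition holds
    automatically. *)
Lemma gamma_st_universal (G : sgraph) (c : G) :
  (forall x, x != c -> adj x c) -> gamma_st G <= 1.
Proof.
move=> univ; rewrite -(cards1 c); apply/gamma_st_le/strong_dominatingP => x.
rewrite inE => xc; exists c; split; rewrite ?set11 ?univ //.
have /subset_leq_card le_x : nbhd x \subset [set~ x].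
  by apply/subsetP => y; rewrite !inE; case: eqP => // ->; rewrite adj_irrefl.
apply: leq_trans le_x _; rewrite cardsC1 -(cardsC1 c).
by apply/subset_leq_card/subsetP => y; rewrite !inE adj_sym; apply: univ.
Qed.

Section Pendant.
Variables (G : sgraph) (u v : G).
Hypotheses (deg_v : deg v = 1) (adj_uv : adj u v).

Lemma adj_pendant x : adj v x = (x == u).
Proof.
have /cards1P[w nv] : #|nbhd v| == 1 by apply/eqP.
have in_nv y : adj v y = (y == w) by rewrite -in_set1 -nv inE.
by have := in_nv u; rewrite adj_sym adj_uv => /esym/eqP->.
Qed.

Lemma pendant_neq : u != v.
Proof. by apply: contraTneq adj_uv => ->; rewrite adj_irrefl. Qed.

(** The neighbourhood of [v] is the single vertex [u], so turning it into a clique adds no edge. *)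
Lemma contract_adjE (x y : contract v) : adj x y = adj (val x) (val y).
Proof.
have [-> | nxy] := eqVneq x y; first by rewrite !adj_irrefl.
rewrite /= /contract_adj nxy !inE !adj_pendant; apply: orb_idr.
case/andP=> /eqP xu /eqP yu.
by case/eqP: nxy; apply: val_inj; rewrite xu yu.
Qed.

Lemma contract_deg (x : contract v) : deg x = #|nbhd (val x) :\ v|.
Proof.
rewrite /deg -(card_imset _ val_inj); apply: eq_card => y.
apply/imsetP/idP => [[z] | ]; rewrite !inE.
  by rewrite contract_adjE => xz ->; rewrite xz (valP z).
by case/andP=> yv xy; exists (Sub y yv : contract v); rewrite ?inE ?contract_adjE.
Qed.

Lemma contract_deg_le (x : contract v) : deg x <= deg (val x).
Proof. by rewrite contract_deg subset_leq_card ?subsetDl. Qed.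

Lemma contract_deg_neq (x : contract v) : val x != u -> deg x = deg (val x).
Proof.
move=> xu; rewrite contract_deg /deg (cardsD1 v (nbhd (val x))).
by rewrite inE adj_sym adj_pendant (negPf xu).
Qed.

Lemma gamma_st_le_contract : gamma_st G <= (gamma_st (contract v)).+1.
Proof.
have [D /strong_dominatingP sD <-] := gamma_st_attained (contract v).
apply: leq_trans (_ : #|u |: val @: D| <= _); last first.
  by rewrite cardsU1 (card_imset _ val_inj) -add1n leq_add2r leq_b1.
apply/gamma_st_le/strong_dominatingP => x.
rewrite !inE negb_or => /andP[xu xD].
have [-> | xv] := eqVneq x v.
  exists u; rewrite !inE eqxx adj_sym adj_uv deg_v; split=> //.
  by apply/card_gt0P; exists v; rewrite inE.
pose x' : contract v := Sub x xv.
have /sD[y [yD xy le_xy]] : x' \notin D.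
  by apply: contraNN xD => x'D; apply/imsetP; exists x'.
exists (val y); split; first by rewrite !inE imset_f ?orbT.
  by move: xy; rewrite contract_adjE.
(* Back in [G], the degree of [x] is unchanged because [x] is not [u], while that of its dominator
   can only grow. *)
by rewrite -(contract_deg_neq x' xu) (leq_trans le_xy) ?contract_deg_le.
Qed.

Lemma gamma_st_contract_le : gamma_st (contract v) <= gamma_st G + deg u - 1.
Proof.
have [D /strong_dominatingP sD <-] := gamma_st_attained G.
pose E := D :|: (u |: nbhd u).
apply: leq_trans (_ : #|val @^-1: E : {set contract v}| <= _).
  apply/gamma_st_le/strong_dominatingP => x; rewrite !inE !negb_or.
  case/and3P=> xD xu ux; have [y [yD xy le_xy]] := sD _ xD.
  (* Since [x] is neither [u] nor a neighbour of [u], its dominator [y] is neither [u] nor [v].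
     Hence [y] survives the contraction, and both [x] and [y] keep their degrees. *)
  have yu : y != u by apply: contraNneq ux => <-; rewrite adj_sym.
  have yv : y != v by apply: contraNneq xu => yv; rewrite -adj_pendant adj_sym; move: xy; rewrite yv.
  exists (Sub y yv : contract v).
  by rewrite contract_adjE !contract_deg_neq //= !inE yD xy.
rewrite -(card_imset _ val_inj).
have /subset_leq_card le_E : val @: (val @^-1: E : {set contract v}) \subset E :\ v.
  by apply/subsetP => _ /imsetP[x xE ->]; rewrite 2!inE (valP x); rewrite inE in xE.
apply: leq_trans le_E _.
have vE : v \in nbhd u by rewrite inE.
(* Removing [v] from [nbhd u] leaves [deg u - 1] vertices, so it remains to bound [(u |: D) :\ v] by
   [#|D|]. *)
have -> : E :\ v = (u |: D) :\ v :|: nbhd u :\ v by rewrite -setDUl /E setUCA setUA.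
apply: leq_trans (leq_card_setU _ _) _.
rewrite /deg (cardsD1 v (nbhd u)) vE addnCA add1n subn1 leq_add2r.
have := cardsD1 v (u |: D); rewrite cardsU1 !inE eq_sym (negPf pendant_neq) /=.
(* If [v] is in [D], its removal pays for adding [u]. Otherwise only [u] can dominate [v], so [u] is
   already in [D]. *)
have [vD | vD] := boolP (v \in D).
  by move=> eqD; rewrite -ltnS -[_.+1]add1n -eqD -add1n leq_add2r leq_b1.
have [y [yD]] := sD _ vD; rewrite adj_pendant => /eqP yu _.
by rewrite -yu yD !add0n => ->.
Qed.

End Pendant.

Definition path_adj (n : nat) : rel 'I_n := fun i j => (i.+1 == j) || (j.+1 == i).

Lemma path_adj_sym n : symmetric (@path_adj n).
Proof. by move=> i j; rewrite /path_adj orbC. Qed.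

Lemma path_adj_irrefl n : irreflexive (@path_adj n).
Proof. by move=> i; rewrite /path_adj -[X in _ == X]addn0 -addn1 eqn_add2l. Qed.

Definition path_graph n : sgraph := SGraph (@path_adj_sym n) (@path_adj_irrefl n).

Lemma path_deg0 n : deg (ord0 : path_graph n.+2) = 1.
Proof.
apply/eqP/cards1P; exists (lift ord0 ord0); apply/setP => j.
by rewrite !inE /= /path_adj orbF eq_sym -val_eqE.
Qed.

Lemma path_adj10 n : adj (lift ord0 ord0 : path_graph n.+2) ord0.
Proof. by []. Qed.

Lemma path_deg1 : deg (lift ord0 ord0 : path_graph 2) = 1.
Proof.
apply/eqP/cards1P; exists ord0; apply/setP => j.
by rewrite !inE; case: j => [[|[|]]].
Qed.

Lemma gamma_st_path4 :
  gamma_st (path_graph 4) - 1 = gamma_st (contract (ord0 : path_graph 4)).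
Proof.
have deg0 := path_deg0 2; have adj10 := path_adj10 2.
apply/eqP; rewrite eqn_leq leq_subLR add1n (gamma_st_le_contract _ _ _ deg0 adj10) /=.
(* Deleting the end [0] leaves the path 1, 2, 3, whose middle vertex 2 is adjacent to both
   others. *)
pose c : contract (ord0 : path_graph 4) := 
  Sub (lift ord0 (lift ord0 ord0)) isT.
apply: leq_trans (_ : 1 <= _).
  apply: (gamma_st_universal _ c) => x.
  rewrite (contract_adjE _ _ _ deg0 adj10) -val_eqE /=.
  by case: x => [[[|[|[|[|]]]]]].
rewrite subn_gt0; apply: (gamma_st_gt1 (path_graph 4) ord0) => y.
(* Each vertex of the path misses the end in the opposite half, so the strong domination number is
   at least 2. *)
exists (if y <= 1 then ord_max else ord0); by case: y => [[|[|[|[|]]]]].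
Qed.

(** Here [deg u] is 1, so the upper bound is the strong domination number of an edge, namely 1,
    which is also that of the single vertex left. *)
Lemma gamma_st_path2 :
  gamma_st (contract (ord0 : path_graph 2)) =
    gamma_st (path_graph 2) + deg (lift ord0 ord0 : path_graph 2) - 1.
Proof.
have deg0 := path_deg0 0; have adj10 := path_adj10 0.
apply/eqP; rewrite eqn_leq (gamma_st_contract_le _ _ _ deg0 adj10) /=.
rewrite path_deg1 addnK.
apply: leq_trans (_ : 1 <= _).
  by apply: (gamma_st_universal (path_graph 2) ord0) => -[[|[|]]].
pose w : contract (ord0 : path_graph 2) := Sub (lift ord0 ord0) isT.
exact: gamma_st_gt0 w.
Qed.

Theorem theorem3 :
  (forall (G : sgraph) (u v : G), deg v = 1 -> adj u v ->
     gamma_st G - 1 <= gamma_st (contract v) /\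
     gamma_st (contract v) <= gamma_st G + deg u - 1) /\
  (exists (G : sgraph) (u v : G), deg v = 1 /\ adj u v /\
     gamma_st G - 1 = gamma_st (contract v)) /\
  (exists (G : sgraph) (u v : G), deg v = 1 /\ adj u v /\
     gamma_st (contract v) = gamma_st G + deg u - 1).
Proof.
split=> [G u v deg_v uv | ].
  rewrite leq_subLR add1n; split; first exact: (gamma_st_le_contract _ u).
  exact: gamma_st_contract_le.
split; [exists (path_graph 4) | exists (path_graph 2)];
  exists (lift ord0 ord0), ord0; rewrite path_deg0 path_adj10.
- by rewrite gamma_st_path4.
- by rewrite gamma_st_path2.
Qed.
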